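(* In the setting given in the context, assume $\omega_i\neq 0$ for all $i\in\{1,\dots,n\}$, and define $\kappa^*\in\mathbb{R}^n$ by $$\kappa_i^*\triangleq -\frac{\sigma_i}{\omega_i},\qquad i\in\{1,\dots,n\}.$$ Suppose $\kappa^*\in\mathcal{K}^\bullet$. Then $\kappa^*$ is a global solution of $\min_{\kappa\in\mathcal{K}} I(\kappa)$, and $$\min_{\kappa\in\mathcal{K}} I(\kappa)=I(\kappa^* )=\|m^\bullet\|_1 .$$ The pair $(\alpha^*,\xi^* )\in\mathcal{A}$ corresponding to $\kappa^*$ (that is, the one with $k(\alpha_i^*,\xi_i^* )=\kappa_i^*$ for all $i$) is given by $$\alpha_i^*=\frac{1}{\sqrt{1+(\kappa_i^* )^2}}=\frac{1}{\sqrt{1+(\sigma_i/\omega_i)^2}},\qquad \xi_i^*=\operatorname{sign}(\kappa_i^* )=-\operatorname{sign}(\sigma_i\omega_i),\qquad i\in\{1,\dots,n\}.$$ Every $p^*\in\mathcal{P}(\kappa^* )$ is a worst-case realization, i.e. attains the maximum defining $I(\kappa^* )$. In particular, the choice $p_i^*=1/\sqrt{1+(\kappa_i^* )^2}$ with $q_i^*=\kappa_i^*p_i^*$ satisfies $(p_i^* )^2+(q_i^* )^2=1$ for all $i$.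
   Context: Let $n\ge 1$, and let $R,X\in\mathbb{R}^{n\times n}$ be arbitrary fixed matrices. Let $\underline{m},\overline{m},m^\bullet\in\mathbb{R}^n$ satisfy $\underline{m}\le 0\le\overline{m}$ and $\underline{m}\le m^\bullet\le\overline{m}$ componentwise, and let $\underline{\alpha}\in\mathbb{R}^n$ with $0<\underline{\alpha}_i\le 1$ for all $i$. Vector inequalities are componentwise, and $\operatorname{sign}$ takes values in $\{-1,0,1\}$ with $\operatorname{sign}(0)=0$, applied componentwise to vectors. For $\alpha_i\in(0,1]$ and $\xi_i\in\{-1,0,1\}$ put $k(\alpha_i,\xi_i)\triangleq\frac{\xi_i}{\alpha_i}\sqrt{1-\alpha_i^2}$, and for vectors write $k(\alpha,\xi)$ for the vector with entries $k(\alpha_i,\xi_i)$. Let $\mathcal{P}\triangleq[0,1]^n$. The set $\mathcal{A}$ consists of all $(\alpha,\xi)\in(0,1]^n\times\{-1,0,1\}^n$ such that $\underline{\alpha}\le\alpha\le\mathbf{1}$; for each $i$, $\xi_i\in\{-1,1\}$ if $\alpha_i<1$ and $\xi_i=0$ if $\alpha_i=1$; and $\underline{m}\le (R+X\operatorname{diag}(k(\alpha,\xi)))p'\le\overline{m}$ for all $p'\in\mathcal{P}$. For $\kappa\in\mathbb{R}^n$ set $\tilde S(\kappa)\triangleq R+X\operatorname{diag}(\kappa)$ and $\mathcal{P}(\kappa)\triangleq\prod_{i=1}^n\left[0,\frac{1}{\sqrt{1+\kappa_i^2}}\right]$. Define $$\mathcal{K}\triangleq\left\{\kappa\in\mathbb{R}^n:\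 |\kappa_i|\le\frac{\sqrt{1-\underline{\alpha}_i^2}}{\underline{\alpha}_i}\ \forall i,\ \ \underline{m}\le\tilde S(\kappa)p'\le\overline{m}\ \ \forall p'\in\mathcal{P}\right\}.$$ For $\kappa\in\mathcal{K}$ and $p\in\mathcal{P}(\kappa)$ let $\tilde w(p,\kappa)\triangleq\|m^\bullet-\tilde S(\kappa)p\|_1$ and $I(\kappa)\triangleq\max_{p\in\mathcal{P}(\kappa)}\tilde w(p,\kappa)$. Let $s^\bullet\triangleq\operatorname{sign}(m^\bullet)$, and for $\kappa\in\mathcal{K}$ let $\mathcal{R}_{s^\bullet}(\kappa)\triangleq\{p\in\mathcal{P}(\kappa):\operatorname{sign}(m^\bullet-\tilde S(\kappa)p)=s^\bullet\}$. Define $\mathcal{K}^\bullet\triangleq\{\kappa\in\mathcal{K}:\mathcal{P}(\kappa)=\overline{\mathcal{R}_{s^\bullet}(\kappa)}\}$, where the overline denotes closure in $\mathbb{R}^n$. Finally, $\sigma\triangleq-R^\top s^\bullet$ and $\omega\triangleq-X^\top s^\bullet$. *)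

(* Defs.v *)
From HB Require Import structures.
From mathcomp Require Import all_boot all_order all_algebra.
From mathcomp Require Import all_classical all_reals all_analysis.

Set Implicit Arguments.
Unset Strict Implicit.
Unset Printing Implicit Defensive.

Import Order.TTheory GRing.Theory Num.Theory.
Import numFieldNormedType.Exports.

Local Open Scope classical_set_scope.
Local Open Scope ring_scope.

Definition vle (R : realType) (n : nat) (u v : 'cV[R]_n) : Prop :=
  forall i, u i 0 <= v i 0.

(* The library norm `|v| on matrices is the max norm, hence this l^1 norm. *)
Definition norm1 (R : realType) (n : nat) (v : 'cV[R]_n) : R :=
  \sum_i `|v i 0|.

(* Num.sg takes the values -1, 0, 1, with Num.sg 0 = 0. *)
Definition signv (R : realType) (n : nat) (v : 'cV[R]_n) : 'cV[R]_n :=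
  map_mx Num.sg v.

Definition is_maximizer (T : Type) (R : realType) (f : T -> R) (A : set T)
    (x : T) : Prop :=
  A x /\ forall y, A y -> f y <= f x.

Definition is_minimizer (T : Type) (R : realType) (f : T -> R) (A : set T)
    (x : T) : Prop :=
  A x /\ forall y, A y -> f x <= f y.

Definition kfun (R : realType) (a x : R) : R := x / a * Num.sqrt (1 - a ^+ 2).

Definition kvec (R : realType) (n : nat) (alpha xi : 'cV[R]_n) : 'cV[R]_n :=
  \col_i kfun (alpha i 0) (xi i 0).

Definition unit_box (R : realType) (n : nat) : set 'cV[R]_n :=
  [set p : 'cV[R]_n | forall i, 0 <= p i 0 <= 1].

(* diag_mx expects a row vector, hence the transpose. *)
Definition Stilde (R : realType) (n : nat) (Rm Xm : 'M[R]_n)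
    (kappa : 'cV[R]_n) : 'M[R]_n :=
  Rm + Xm *m diag_mx kappa^T.

Definition Aset (R : realType) (n : nat) (Rm Xm : 'M[R]_n)
    (mlo mhi alo : 'cV[R]_n) : set ('cV[R]_n * 'cV[R]_n) :=
  [set ax : 'cV[R]_n * 'cV[R]_n |
    [/\ forall i, 0 < ax.1 i 0 <= 1,
        forall i, ax.2 i 0 \in [:: -1; 0; 1],
        vle alo ax.1 /\ vle ax.1 (const_mx 1),
        forall i, (ax.1 i 0 < 1 -> ax.2 i 0 \in [:: -1; 1]) /\
                  (ax.1 i 0 = 1 -> ax.2 i 0 = 0)
      & forall p : 'cV[R]_n, unit_box p ->
          vle mlo ((Rm + Xm *m diag_mx (kvec ax.1 ax.2)^T) *m p) /\
          vle ((Rm + Xm *m diag_mx (kvec ax.1 ax.2)^T) *m p) mhi]].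

Definition kbox (R : realType) (n : nat) (kappa : 'cV[R]_n) : set 'cV[R]_n :=
  [set p : 'cV[R]_n | forall i, 0 <= p i 0 <= 1 / Num.sqrt (1 + kappa i 0 ^+ 2)].

Definition Kset (R : realType) (n : nat) (Rm Xm : 'M[R]_n)
    (mlo mhi alo : 'cV[R]_n) : set 'cV[R]_n :=
  [set kappa : 'cV[R]_n |
    (forall i, `|kappa i 0| <= Num.sqrt (1 - alo i 0 ^+ 2) / alo i 0) /\
    (forall p : 'cV[R]_n, unit_box p ->
       vle mlo (Stilde Rm Xm kappa *m p) /\
       vle (Stilde Rm Xm kappa *m p) mhi)].

Definition wtilde (R : realType) (n : nat) (Rm Xm : 'M[R]_n)
    (mb p kappa : 'cV[R]_n) : R :=
  norm1 (mb - Stilde Rm Xm kappa *m p).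

(* The supremum is a maximum: see Ival_max below. *)
Definition Ival (R : realType) (n : nat) (Rm Xm : 'M[R]_n) (mb : 'cV[R]_n)
    (kappa : 'cV[R]_n) : R :=
  sup [set wtilde Rm Xm mb p kappa | p in kbox kappa].

Definition sbullet (R : realType) (n : nat) (mb : 'cV[R]_n) : 'cV[R]_n :=
  signv mb.

Definition Rregion (R : realType) (n : nat) (Rm Xm : 'M[R]_n) (mb : 'cV[R]_n)
    (kappa : 'cV[R]_n) : set 'cV[R]_n :=
  [set p : 'cV[R]_n | kbox kappa p /\ signv (mb - Stilde Rm Xm kappa *m p) = sbullet mb].

Definition Kbullet (R : realType) (n : nat) (Rm Xm : 'M[R]_n)
    (mlo mhi mb alo : 'cV[R]_n) : set 'cV[R]_n :=
  [set kappa : 'cV[R]_n | Kset Rm Xm mlo mhi alo kappa /\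
               kbox kappa = closure (Rregion Rm Xm mb kappa)].

Definition sigmav (R : realType) (n : nat) (Rm : 'M[R]_n) (mb : 'cV[R]_n) :
    'cV[R]_n :=
  - (Rm^T *m sbullet mb).

Definition omegav (R : realType) (n : nat) (Xm : 'M[R]_n) (mb : 'cV[R]_n) :
    'cV[R]_n :=
  - (Xm^T *m sbullet mb).

Lemma kbox0 (R : realType) (n : nat) (kappa : 'cV[R]_n) : kbox kappa 0.
Proof. by move=> i; rewrite mxE lexx /= mul1r invr_ge0 sqrtr_ge0. Qed.

Lemma trmx_continuous (R : realType) (m n : nat) :
  continuous (fun v : 'M[R]_(m, n) => v^T).
Proof.
move=> v A [B nB sBA]; exists (fun i j => B j i) => [i j|w Bw].
  by have := nB j i; rewrite mxE.
by apply: sBA => i j; rewrite mxE.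
Qed.

Lemma kbox_compact (R : realType) (n : nat) (kappa : 'cV[R]_n) :
  compact (kbox kappa).
Proof.
pose b i : set R := `[0, 1 / Num.sqrt (1 + kappa i 0 ^+ 2)]%classic.
have cb := @rV_compact R n b (fun i => @segment_compact _ _ _).
have -> : kbox kappa = (fun v : 'rV[R]_n => v^T) @`
    [set v : 'rV[R]_n | forall i, b i (v 0 i)].
  apply/seteqP; split => [p hp|_ [v hv <-] i].
    by exists p^T; rewrite ?trmxK // => i; rewrite /b /= in_itv /= mxE; exact: hp.
  by have := hv i; rewrite /b /= in_itv /= mxE.
apply: continuous_compact => //; apply: continuous_subspaceT.
exact: trmx_continuous.
Qed.

Lemma wtilde_continuous (R : realType) (n : nat) (Rm Xm : 'M[R]_n)
    (mb kappa : 'cV[R]_n) :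
  continuous (fun p : 'cV[R]_n => wtilde Rm Xm mb p kappa).
Proof.
have csum (T : topologicalType) (F : 'I_n -> T -> R) :
    (forall i, continuous (F i)) -> continuous (fun p => \sum_i F i p).
  move=> cF p; elim: (index_enum _) => [|i r IH].
    under eq_fun do rewrite big_nil.
    exact: cst_continuous.
  under eq_fun do rewrite big_cons.
  by apply: cvgD => //; exact: cF.
have caff (T : topologicalType) (c : R) (g : T -> R) : continuous g ->
    continuous (fun p => `|c - g p|).
  by move=> cg p; apply: cvg_norm; apply: cvgB; [exact: cvg_cst|exact: cg].
have cscale (T : topologicalType) (c : R) (g : T -> R) : continuous g ->
    continuous (fun p => c * g p).
  by move=> cg p; apply: cvgM; [exact: cvg_cst|exact: cg].
have -> : (fun p : 'cV[R]_n => wtilde Rm Xm mb p kappa) =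
    (fun p => \sum_i `|mb i 0 - \sum_j Stilde Rm Xm kappa i j * p j 0|).
  by apply/funext => p; apply: eq_bigr => i _; rewrite !mxE.
apply: (csum) => i; apply: caff; apply: csum => j; apply: cscale.
exact: coord_continuous.
Qed.

Lemma Ival_max (R : realType) (n : nat) (Rm Xm : 'M[R]_n)
    (mb kappa : 'cV[R]_n) :
  exists2 p, is_maximizer (fun p => wtilde Rm Xm mb p kappa) (kbox kappa) p
           & wtilde Rm Xm mb p kappa = Ival Rm Xm mb kappa.
Proof.
pose f p := wtilde Rm Xm mb p kappa.
have [|||p /set_mem kp maxp] := @compact_EVT_max _ R f (kbox kappa).
- by exists 0; exact: kbox0.
- exact: kbox_compact.
- exact/continuous_subspaceT/wtilde_continuous.
have le_max q : kbox kappa q -> f q <= f p by move=> kq; exact/maxp/mem_set.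
have ubp : ubound [set f q | q in kbox kappa] (f p).
  by move=> _ [q kq <-]; exact: le_max.
exists p; first by split.
apply/eqP; rewrite eq_le; apply/andP; split.
  by apply: ub_le_sup; [exists (f p) | exists p].
by apply: ge_sup => //; exists (f p), p.
Qed.

(* Main.v *)
(* At kappas the vector s = sign(mb) is orthogonal to every column of Stilde, so
   wtilde, which is s^T (mb - Stilde p) wherever the residual has sign pattern s,
   equals the constant ||mb||_1 on that region, hence on its closure, the whole
   box.  Every other kappa does at least as badly, since p = 0 always lies in the
   box and has value ||mb||_1. *)
Require Import Defs.
From HB Require Import structures.
From mathcomp Require Import all_boot all_order all_algebra.
From mathcomp Require Import all_classical all_reals all_analysis.
From mathcomp Require Import ring lra.

Set Implicit Arguments.
Unset Strict Implicit.
Unset Printing Implicit Defensive.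

Import Order.TTheory GRing.Theory Num.Theory.
Import numFieldNormedType.Exports.

Local Open Scope classical_set_scope.
Local Open Scope ring_scope.

Section PolarParametrization.
Variable R : realType.
Implicit Types a k x : R.

Lemma sqrt1Dsqr_gt0 k : 0 < Num.sqrt (1 + k ^+ 2).
Proof. by rewrite sqrtr_gt0 ltr_pwDl // sqr_ge0. Qed.

Lemma sqr_invsqrt k : (1 / Num.sqrt (1 + k ^+ 2)) ^+ 2 = (1 + k ^+ 2)^-1.
Proof. by rewrite mul1r exprVn sqr_sqrtr // addr_ge0 // sqr_ge0. Qed.

Lemma invsqrt_itv k : 0 < 1 / Num.sqrt (1 + k ^+ 2) <= 1.
Proof.
rewrite mul1r invr_gt0 sqrt1Dsqr_gt0 /= invf_le1 ?sqrt1Dsqr_gt0 //.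
by rewrite -[leLHS]sqrtr1 ler_wsqrtr // lerDl sqr_ge0.
Qed.

(** Matches the convention of [Aset] that the sign entry vanishes exactly where alpha equals 1. *)
Lemma invsqrt_eq1 k : (1 / Num.sqrt (1 + k ^+ 2) == 1) = (k == 0).
Proof.
apply/eqP/eqP => [a1|->]; last by rewrite expr0n addr0 sqrtr1 divr1.
have := sqr_invsqrt k; rewrite a1 expr1n => /esym/(congr1 GRing.inv).
rewrite invrK invr1 => /eqP.
by rewrite -subr_eq0 addrAC subrr add0r sqrf_eq0 => /eqP.
Qed.

Lemma invsqrt_circle k :
  (1 / Num.sqrt (1 + k ^+ 2)) ^+ 2 + (k * (1 / Num.sqrt (1 + k ^+ 2))) ^+ 2 = 1.
Proof.
have k1 : 1 + k ^+ 2 != 0 by rewrite gt_eqF // ltr_pwDl // sqr_ge0.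
by rewrite [(k * _) ^+ 2]exprMn sqr_invsqrt -[X in X + _]mul1r -mulrDl divff.
Qed.

(** Think of k as a tangent and of a = 1 / sqrt(1 + k^2) as the cosine. The circle identity turns 1
    - a^2 into (k a)^2, whose root is |k| a; then a cancels and sg k * |k| = k remains. *)
Lemma kfun_invsqrt k : kfun (1 / Num.sqrt (1 + k ^+ 2)) (Num.sg k) = k.
Proof.
have /andP[a0 _] := invsqrt_itv k.
rewrite /kfun -[X in X - _ ^+ 2](invsqrt_circle k) addrAC subrr add0r.
by rewrite sqrtr_sqr normrM (gtr0_norm a0) mulrCA divfK ?gt_eqF // mulrC -numEsg.
Qed.

(** This gives uniqueness of the pair in [Aset]. If a = 1, then x = 0 and k = 0. If a < 1, then x^2
    = 1 yields 1 + k^2 = a^-2, and k has the sign of x because its other factors are positive. *)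
Lemma kfun_inv a x k : 0 < a <= 1 -> (a < 1 -> x \in [:: -1; 1]) ->
  (a = 1 -> x = 0) -> kfun a x = k ->
  a = 1 / Num.sqrt (1 + k ^+ 2) /\ x = Num.sg k.
Proof.
move=> /andP[a0]; rewrite le_eqVlt => /predU1P[->|a1] xlt xeq <-.
  by rewrite xeq // /kfun !mul0r expr0n addr0 sqrtr1 divr1 sgr0.
have sa : 0 < 1 - a ^+ 2 by rewrite subr_gt0 expr_lt1 // ltW.
have [x2 sgx] : x ^+ 2 = 1 /\ Num.sg x = x.
  by have := xlt a1; rewrite !inE => /orP[]/eqP->;
    rewrite ?sqrrN expr1n ?sgrN sgr1.
split; last first.
  have s0 : 0 < Num.sqrt (1 - a ^+ 2) by rewrite sqrtr_gt0.
  by rewrite /kfun !sgrM sgrV (gtr0_sg a0) (gtr0_sg s0) !mulr1.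
rewrite /kfun exprMn sqr_sqrtr ?ltW // expr_div_n x2.
have -> : 1 + 1 / a ^+ 2 * (1 - a ^+ 2) = a^-1 ^+ 2.
  by field; rewrite gt_eqF.
by rewrite sqrtr_sqr gtr0_norm ?invr_gt0 // mul1r invrK.
Qed.

(** Carries the bound of [Kset] on kappa to the lower bound of [Aset] on alpha: after squaring, k^2
    a^2 <= 1 - a^2 rearranges to a^2 (1 + k^2) <= 1. *)
Lemma le_invsqrt a k : 0 < a <= 1 -> `|k| <= Num.sqrt (1 - a ^+ 2) / a ->
  a <= 1 / Num.sqrt (1 + k ^+ 2).
Proof.
move=> /andP[a0 a1]; rewrite ler_pdivlMr // => ka.
rewrite ler_pdivlMr ?sqrt1Dsqr_gt0 //.
have sa : 0 <= 1 - a ^+ 2 by rewrite subr_ge0 expr_le1 // ltW.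
rewrite -(@ler_pXn2r _ 2) ?nnegrE ?mulr_ge0 ?sqrtr_ge0 ?(ltW a0) //.
rewrite exprMn sqr_sqrtr ?addr_ge0 ?sqr_ge0 //.
have : (`|k| * a) ^+ 2 <= Num.sqrt (1 - a ^+ 2) ^+ 2.
  by rewrite ler_pXn2r ?nnegrE ?mulr_ge0 ?sqrtr_ge0 ?(ltW a0).
rewrite sqr_sqrtr // exprMn real_normK ?num_real //; lra.
Qed.

End PolarParametrization.

(** Makes the l^1 norm linear on any set of vectors sharing one sign pattern. *)
Lemma norm1_sg (R : realType) (n : nat) (v : 'cV[R]_n) :
  norm1 v = ((signv v)^T *m v) 0 0.
Proof. by rewrite mxE; apply: eq_bigr => i _; rewrite !mxE normrEsg. Qed.

Lemma wtilde0 (R : realType) (n : nat) (Rm Xm : 'M[R]_n) (mb kappa : 'cV[R]_n) :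
  wtilde Rm Xm mb 0 kappa = norm1 mb.
Proof. by rewrite /wtilde mulmx0 subr0. Qed.

(** Explains the choice of [kappas]: for nonzero omega_j, this entry vanishes exactly when kappa_j =
    - sigma_j / omega_j. *)
Lemma sbullet_Stilde (R : realType) (n : nat) (Rm Xm : 'M[R]_n)
    (mb kappa : 'cV[R]_n) (j : 'I_n) :
  ((sbullet mb)^T *m Stilde Rm Xm kappa) 0 j =
  - (sigmav Rm mb j 0 + kappa j 0 * omegav Xm mb j 0).
Proof.
rewrite /Stilde /sigmav /omegav mulmxDr mulmxA.
rewrite -(trmxK Rm) -(trmxK Xm) -!trmx_mul !trmxK mxE mul_mx_diag !mxE.
by rewrite mulrN -opprD opprK [kappa j 0 * _]mulrC.
Qed.

Lemma wtilde_le_Ival (R : realType) (n : nat) (Rm Xm : 'M[R]_n)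
    (mb kappa p : 'cV[R]_n) :
  kbox kappa p -> wtilde Rm Xm mb p kappa <= Ival Rm Xm mb kappa.
Proof. by have [q [_ maxq] <-] := Ival_max Rm Xm mb kappa => /maxq. Qed.

Lemma wtilde_closure_Rregion (R : realType) (n : nat) (Rm Xm : 'M[R]_n)
    (mb kappa : 'cV[R]_n) :
  (sbullet mb)^T *m Stilde Rm Xm kappa = 0 ->
  forall p, closure (Rregion Rm Xm mb kappa) p ->
    wtilde Rm Xm mb p kappa = norm1 mb.
Proof.
move=> sS0 p clp.
pose level := (fun q => wtilde Rm Xm mb q kappa) @^-1` [set norm1 mb].
have closed_level : closed level.
  apply: preimage_closed; last exact: closed_eq.
  by move=> q _; exact: wtilde_continuous.
(* A closed level set containing the region contains its closure. *)
apply: (closed_level p); apply: closureS clp => q [_ sgq].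
by rewrite /level /= /wtilde !norm1_sg sgq mulmxBr mulmxA sS0 mul0mx subr0.
Qed.

Lemma Aset_invsqrt (R : realType) (n : nat) (Rm Xm : 'M[R]_n)
    (mlo mhi alo kappa : 'cV[R]_n) :
  (forall i, 0 < alo i 0 <= 1) -> Kset Rm Xm mlo mhi alo kappa ->
  let ax := (\col_i (1 / Num.sqrt (1 + kappa i 0 ^+ 2)), signv kappa) in
  Aset Rm Xm mlo mhi alo ax /\ kvec ax.1 ax.2 = kappa.
Proof.
move=> alo_bounds [kle kbd] ax.
have axK : kvec ax.1 ax.2 = kappa.
  by apply/matrixP => i j; rewrite ord1 !mxE kfun_invsqrt.
split=> //; split.
- by move=> i; rewrite mxE invsqrt_itv.
- by move=> i; rewrite mxE; case: sgrP; rewrite !inE eqxx ?orbT.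
- split=> i; rewrite !mxE; first exact: le_invsqrt.
  by case/andP: (invsqrt_itv (kappa i 0)).
- move=> i; rewrite !mxE; split=> [/lt_eqF/negbT|/eqP]; rewrite invsqrt_eq1.
    by case: sgrP => // _ _; rewrite !inE eqxx ?orbT.
  by move/eqP->; rewrite sgr0.
- by move=> p; rewrite axK; exact: kbd.
Qed.

Lemma Aset_kvec_inv (R : realType) (n : nat) (Rm Xm : 'M[R]_n)
    (mlo mhi alo alpha xi : 'cV[R]_n) :
  Aset Rm Xm mlo mhi alo (alpha, xi) -> forall i,
  let k := kvec alpha xi i 0 in
  alpha i 0 = 1 / Num.sqrt (1 + k ^+ 2) /\ xi i 0 = Num.sg k.
Proof.
case=> /= a01 _ _ axi _ i; have [xlt xeq] := axi i.
by apply: kfun_inv => //; rewrite mxE.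
Qed.

Theorem theorem1 (R : realType) (n : nat) (n_ge1 : (1 <= n)%N)
    (Rm Xm : 'M[R]_n) (mlo mhi mb alo : 'cV[R]_n)
    (m_lo0 : vle mlo 0) (m_0hi : vle 0 mhi)
    (mb_lo : vle mlo mb) (mb_hi : vle mb mhi)
    (alo_bounds : forall i, 0 < alo i 0 <= 1)
    (sigma omega : 'cV[R]_n)
    (sigma_def : sigma = sigmav Rm mb) (omega_def : omega = omegav Xm mb)
    (omega_neq0 : forall i, omega i 0 != 0)
    (kappas : 'cV[R]_n)
    (kappas_def : forall i, kappas i 0 = - (sigma i 0 / omega i 0))
    (kappas_in : Kbullet Rm Xm mlo mhi mb alo kappas) :
  [/\ (* kappas is a global solution of the minimization problem *)
      is_minimizer (Ival Rm Xm mb) (Kset Rm Xm mlo mhi alo) kappas,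
      (* the optimal value *)
      inf [set Ival Rm Xm mb kappa | kappa in Kset Rm Xm mlo mhi alo]
        = Ival Rm Xm mb kappas /\
      Ival Rm Xm mb kappas = norm1 mb,
      (* the unique corresponding pair in the set A, and its formulas *)
      (exists! ax : 'cV[R]_n * 'cV[R]_n,
         Aset Rm Xm mlo mhi alo ax /\ kvec ax.1 ax.2 = kappas) /\
      (forall alphas xis : 'cV[R]_n,
         Aset Rm Xm mlo mhi alo (alphas, xis) -> kvec alphas xis = kappas ->
         forall i,
           [/\ alphas i 0 = 1 / Num.sqrt (1 + kappas i 0 ^+ 2),
               alphas i 0 = 1 / Num.sqrt (1 + (sigma i 0 / omega i 0) ^+ 2),
               xis i 0 = Num.sg (kappas i 0)
             & xis i 0 = - Num.sg (sigma i 0 * omega i 0)]),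
      (* every realization is a worst case *)
      (forall ps : 'cV[R]_n, kbox kappas ps ->
         is_maximizer (fun p => wtilde Rm Xm mb p kappas) (kbox kappas) ps /\
         wtilde Rm Xm mb ps kappas = Ival Rm Xm mb kappas)
    & (* the particular choice lying on the unit circles *)
      (forall ps qs : 'cV[R]_n,
         (forall i, ps i 0 = 1 / Num.sqrt (1 + kappas i 0 ^+ 2)) ->
         (forall i, qs i 0 = kappas i 0 * ps i 0) ->
         [/\ kbox kappas ps,
             is_maximizer (fun p => wtilde Rm Xm mb p kappas) (kbox kappas) ps,
             wtilde Rm Xm mb ps kappas = Ival Rm Xm mb kappas
           & forall i, ps i 0 ^+ 2 + qs i 0 ^+ 2 = 1])].
Proof.
have [kK kcl] := kappas_in.
have sS0 : (sbullet mb)^T *m Stilde Rm Xm kappas = 0.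
  apply/matrixP => i j; rewrite ord1 sbullet_Stilde.
  by rewrite -sigma_def -omega_def kappas_def mulNr divfK // subrr oppr0 mxE.
have wk p : kbox kappas p -> wtilde Rm Xm mb p kappas = norm1 mb.
  by rewrite kcl; exact: wtilde_closure_Rregion.
have Ik : Ival Rm Xm mb kappas = norm1 mb.
  by have [p [kp _] <-] := Ival_max Rm Xm mb kappas; exact: wk.
have Imin kappa : Ival Rm Xm mb kappas <= Ival Rm Xm mb kappa.
  by rewrite Ik -(wtilde0 Rm Xm mb kappa) wtilde_le_Ival //; exact: kbox0.
have worst p : kbox kappas p ->
    is_maximizer (fun p => wtilde Rm Xm mb p kappas) (kbox kappas) p /\
    wtilde Rm Xm mb p kappas = Ival Rm Xm mb kappas.
  by move=> kp; split; [split=> // q kq; rewrite !wk|rewrite wk].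
split.
- by split=> // kappa _; exact: Imin.
- split=> //; apply/eqP; rewrite eq_le; apply/andP; split.
    (* [inf] is meaningful only for a nonempty set bounded below; [Imin] supplies the bound and
       [kappas] the member. *)
    apply: ge_inf; last by exists kappas.
    by exists (Ival Rm Xm mb kappas) => _ [kappa _ <-]; exact: Imin.
  apply: lb_le_inf; first by exists (Ival Rm Xm mb kappas), kappas.
  by move=> _ [kappa _ <-]; exact: Imin.
- split.
    eexists; split; first exact: Aset_invsqrt alo_bounds kK.
    (* Any competing pair is recovered entrywise from its [kvec], here [kappas]. *)
    move=> [alpha xi] [/Aset_kvec_inv axi /= axk]; rewrite axk in axi.
    by congr pair; apply/matrixP => i j; have [] := axi i; rewrite ord1 !mxE.
  move=> alpha xi /Aset_kvec_inv axi axk i; rewrite axk in axi.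
  have [-> ->] := axi i; split=> //; first by rewrite kappas_def sqrrN.
  (* Inversion preserves signs, so sigma / omega and sigma * omega have the same sign. *)
  by rewrite kappas_def sgrN !sgrM sgrV.
- exact: worst.
- move=> ps qs psE qsE.
  have kps : kbox kappas ps.
    by move=> i; rewrite psE lexx andbT; case/andP: (invsqrt_itv (kappas i 0)) => /ltW.
  have [maxps wps] := worst _ kps.
  by split=> // i; rewrite qsE psE invsqrt_circle.
Qed.
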